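(* Let $N\ge0$ be an integer and let $a,b$ be real parameters that are generic, i.e. such that no denominator in the functions below vanishes. For all $m,n\in\{0,\dots,N\}$ the rational function $\mathcal U_m(n;a,b,N)$ of Hahn type obeys the difference equation $$\mathcal B_n\,\mathcal U_m(n+1;a,b,N)-(\mathcal B_n+\mathcal D_n)\,\mathcal U_m(n;a,b,N)+\mathcal D_n\,\mathcal U_m(n-1;a,b,N)$$ $$=m(m+b-N)\Big((a-n)\,\mathcal U_m(n;a,b,N)+n\,\mathcal U_m(n-1;a,b,N)\Big),$$ where $$\mathcal B_n=(n-a)(n-a+1)(n-N),\qquad \mathcal D_n=(n-a)(n-a+b-N)\,n.$$
   Context: Rational functions of Hahn type: for $m=0,\dots,N$, $$\mathcal U_m(x;a,b,N)=\frac{(-1)^m(-N)_m}{(b+1)_m}\sum_{\ell=0}^m\frac{(-x)_\ell(-m)_\ell(b+m-N)_\ell}{\ell!\,(-N)_\ell(a-x)_\ell}$$ (the sum is ${}_3F_2(-x,-m,b+m-N;-N,a-x;1)$), where $(x)_0=1$, $(x)_k=x(x+1)\cdots(x+k-1)$. Terms whose coefficient vanishes ($\mathcal U_m(-1)$ for $n=0$, $\mathcal U_m(N+1)$ for $n=N$) are omitted. *)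

(* Defs.v *)
From mathcomp Require Import all_boot all_order all_algebra.
Set Implicit Arguments.
Unset Strict Implicit.
Unset Printing Implicit Defensive.
Import Order.TTheory GRing.Theory Num.Theory.
Local Open Scope ring_scope.

(* The Pochhammer symbol (x)_k = x (x + 1) ... (x + k - 1). *)
Definition poch (R : realFieldType) (x : R) (k : nat) : R :=
  \prod_(i < k) (x + i%:R).

Definition hahn_den (R : realFieldType) (N l : nat) (x a : R) : R :=
  l`!%:R * poch (- N%:R) l * poch (a - x) l.

(* U_m(x; a, b, N); the sum is 3F2(-x, -m, b+m-N; -N, a-x; 1), which
   terminates at l = m. *)
Definition hahnU (R : realFieldType) (m : nat) (x a b : R) (N : nat) : R :=
  (-1) ^+ m * poch (- N%:R) m / poch (b + 1) m *
  \sum_(l < m.+1)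
     poch (- x) l * poch (- m%:R) l * poch (b + m%:R - N%:R) l
     / hahn_den N l x a.

(* No denominator vanishes in any of the functions U_m, 0 <= m <= N, at the
   grid points x = 0, ..., N. *)
Definition hahn_generic (R : realFieldType) (a b : R) (N : nat) : Prop :=
  forall m x : nat, (m <= N)%N -> (x <= N)%N ->
    poch (b + 1) m != 0 /\
    (forall l : nat, (l <= m)%N -> hahn_den N l x%:R a != 0).

(* At n = 0 (resp. n = N) the terms in U_m(n - 1) (resp. U_m(n + 1)) carry the
   coefficients hahnD and n (resp. hahnB), which are 0, so that these terms
   are 0 whatever value the total division assigns to U_m(-1), U_m(N + 1):
   omitting them and writing them amount to the same. *)
Definition hahnB (R : realFieldType) (a : R) (N n : nat) : R :=
  (n%:R - a) * (n%:R - a + 1) * (n%:R - N%:R).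

Definition hahnD (R : realFieldType) (a b : R) (N n : nat) : R :=
  (n%:R - a) * (n%:R - a + b - N%:R) * n%:R.

(* Main.v *)
(* Put phi_l(x) = (-x)_l / (a-x)_l, so that U_m is a constant times
   sum_l c_l phi_l. With L and M the operators on the two sides of the equation
   (without the eigenvalue), one has
     L phi_l = l (l+b-N) M phi_l - l (l-1-N) M phi_(l-1),
   and the coefficients satisfy
     (l+1) (l-N) c_(l+1) = (l-m) (l+m+b-N) c_l.
   As (l-m) (l+m+b-N) = l (l+b-N) - m (m+b-N), the sum of
   c_l (L - m (m+b-N) M) phi_l telescopes, and the boundary term at l = m
   contains the factor m - m. *)
Require Import Defs.
From mathcomp Require Import all_boot all_order all_algebra.
From mathcomp Require Import ring.
Import Order.TTheory GRing.Theory Num.Theory.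
Local Open Scope ring_scope.

Lemma poch0 {R : realFieldType} (x : R) : poch x 0 = 1.
Proof. by rewrite /poch big_ord0. Qed.

Lemma pochSr {R : realFieldType} (x : R) (k : nat) :
  poch x k.+1 = poch x k * (x + k%:R).
Proof. by rewrite /poch big_ord_recr. Qed.

Lemma pochSl {R : realFieldType} (x : R) (k : nat) :
  poch x k.+1 = x * poch (x + 1) k.
Proof.
rewrite /poch big_ord_recl addr0; congr (_ * _).
by apply: eq_bigr => i _; rewrite /= /bump /= natrD addrA.
Qed.

Definition hahn_phi {R : realFieldType} (a : R) (l : nat) (x : R) : R :=
  poch (- x) l / poch (a - x) l.

Definition hahn_coef {R : realFieldType} (b : R) (N m l : nat) : R :=
  poch (- m%:R) l * poch (b + m%:R - N%:R) l / (l`!%:R * poch (- N%:R) l).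

Definition hahnL {R : realFieldType} (a b : R) (N n : nat) (f : R -> R) : R :=
  hahnB a N n * f (n%:R + 1) - (hahnB a N n + hahnD a b N n) * f n%:R
  + hahnD a b N n * f (n%:R - 1).

Definition hahnM {R : realFieldType} (a : R) (n : nat) (f : R -> R) : R :=
  (a - n%:R) * f n%:R + n%:R * f (n%:R - 1).

Lemma hahnU_phi {R : realFieldType} (m N : nat) (x a b : R) :
  hahnU m x a b N = (-1) ^+ m * poch (- N%:R) m / poch (b + 1) m *
    \sum_(l < m.+1) hahn_coef b N m l * hahn_phi a l x.
Proof.
rewrite /hahnU; congr (_ * _); apply: eq_bigr => l _.
by rewrite /hahn_coef /hahn_phi /hahn_den !invfM; ring.
Qed.

Lemma hahn_coefS {R : realFieldType} (b : R) (N m l : nat) : (l < N)%N ->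
  hahn_coef b N m l.+1 * (l.+1%:R * (l%:R - N%:R)) =
  hahn_coef b N m l * ((l%:R - m%:R) * (l%:R + m%:R + b - N%:R)).
Proof.
move=> lN; rewrite /hahn_coef !pochSr factS natrM !invfM.
(* Only the two new denominator factors, [l + 1] and [l - N], have to cancel; the inverses of the
   older ones stay as atoms. *)
have hl : 1 + l%:R != 0 :> R by rewrite nat1r pnatr_eq0.
have hN : - N%:R + l%:R != 0 :> R.
  by rewrite addrC subr_eq0 eqr_nat neq_ltn lN.
set u := (_ `!)%:R^-1; set v := (poch (- N%:R) l)^-1.
by field; rewrite hl hN.
Qed.

Section Phi.

Context {R : realFieldType} (a b : R) (N n : nat).
Hypothesis hn : (n <= N)%N.
Hypothesis ha : forall x l : nat, (x <= N)%N -> (l <= N)%N ->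
  poch (a - x%:R) l != 0.

Lemma shift_neq0 (x k : nat) : (x <= N)%N -> (k < N)%N ->
  a - x%:R + k%:R != 0.
Proof.
move=> xN kN; have := ha x k.+1 xN kN.
by rewrite pochSr mulf_eq0 => /norP[].
Qed.

(* Also for n = N, where phi at N + 1 may have a zero denominator: both sides
   contain the factor n - N. *)
Lemma hahnB_phi (k : nat) : (k < N)%N ->
  hahnB a N n * hahn_phi a k.+1 (n%:R + 1) =
  (n%:R - N%:R) * (n%:R - a) * (n%:R + 1) * hahn_phi a k n%:R.
Proof.
move=> kN; rewrite /hahnB; have [->|nN] := eqVneq n N.
  by rewrite subrr !(mulr0, mul0r).
have h : a - (n%:R + 1) != 0.
  have := shift_neq0 n.+1 0; rewrite addr0 -natr1; apply.
    by rewrite ltn_neqAle nN.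
  exact: leq_ltn_trans kN.
(* Peeling off first factors moves both symbols from [n + 1] to [n]; [a - n - 1] then cancels
   against [n - a + 1] from [hahnB]. *)
rewrite /hahn_phi !pochSl.
rewrite (_ : a - (n%:R + 1) + 1 = a - n%:R); last by ring.
rewrite (_ : - (n%:R + 1) + 1 = - n%:R); last by ring.
rewrite invfM; set v := (poch _ _)^-1; set u := poch _ _.
by field.
Qed.

(** The factor [n] completes [(1-n)_k] to [-(-n)_(k+1)], so values at [n - 1] become symbols based
    at [n], comparable with the other terms. *)
Lemma phi_pred (k : nat) : a - n%:R != 0 ->
  n%:R * hahn_phi a k (n%:R - 1) =
  - (poch (- n%:R) k.+1 * (a - n%:R) / poch (a - n%:R) k.+1).
Proof.
move=> h; rewrite !pochSl /hahn_phi.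
rewrite opprB [1 - _]addrC addrA invfM.
set v := (poch (a - _ + 1) _)^-1; set u := poch _ _.
by field.
Qed.

Lemma hahnL_phi (k : nat) : (k < N)%N ->
  hahnL a b N n (hahn_phi a k.+1) =
  k.+1%:R * (k.+1%:R + b - N%:R) * hahnM a n (hahn_phi a k.+1)
  - k.+1%:R * (k%:R - N%:R) * hahnM a n (hahn_phi a k).
Proof.
move=> kN; have h0 : a - n%:R != 0.
  by have := shift_neq0 n 0 hn (leq_ltn_trans (leq0n k) kN); rewrite addr0.
rewrite /hahnL hahnB_phi // /hahnM /hahnB /hahnD.
rewrite -[_ * n%:R * hahn_phi _ _ _]mulrA !phi_pred // /hahn_phi !pochSr.
have hq : poch (a - n%:R) k != 0 by apply: ha => //; exact: ltnW.
have hk := shift_neq0 _ _ hn kN.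
rewrite -!natr1.
case: n hn h0 hq hk => [|n'] hn' h0 hq hk.
  (* The denominator a + k + 1 coming from phi_(k+1)(-1) may vanish here, but
     all these terms are killed by the factor (-0)_(k+1). *)
  clear hn' h0; case: k kN hq hk => [|k] kN hq hk.
    rewrite !poch0 subr0 addr0 in hk *.
    rewrite oppr0 !(mulr0, mul0r, oppr0, addr0).
    by field.
  by rewrite pochSl oppr0 !(mul0r, mulr0, oppr0, addr0, add0r, subr0).
(* This last factor of [(a-n)_(k+2)] may lie beyond the range of [ha] at [n], but it is also the
   last factor of [(a-n')_(k+1)] at the grid point [n' = n - 1]. *)
have hS : a - n'.+1%:R + k%:R + 1 != 0.
  have := shift_neq0 _ _ (ltnW hn') kN; rewrite -natr1.
  by rewrite (_ : a - (n'%:R + 1) + k%:R + 1 = a - n'%:R + k%:R) //; ring.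
rewrite -!natr1 in h0 hq hk hS *.
set p := poch (- _) k; set q := poch _ k in hq *.
by field; rewrite addrA hk hq hS.
Qed.

Lemma hahn_sum_telescope (m k : nat) : (m <= N)%N -> (k <= m)%N ->
  \sum_(l < k.+1) hahn_coef b N m l *
     (hahnL a b N n (hahn_phi a l)
      - m%:R * (m%:R + b - N%:R) * hahnM a n (hahn_phi a l)) =
  hahn_coef b N m k * ((k%:R - m%:R) * (k%:R + m%:R + b - N%:R))
  * hahnM a n (hahn_phi a k).
Proof.
move=> mN; elim: k => [_|k IH km].
  (* As [phi_0 = 1], L gives 0 and M gives [a]. *)
  rewrite big_ord_recl big_ord0 /hahnL /hahnM /hahn_phi !poch0.
  by rewrite mulr0n; ring.
have kN : (k < N)%N by apply: leq_trans mN.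
rewrite big_ord_recr /= IH; last exact: ltnW.
(* Read backwards, the recurrence turns the old boundary term into the one that cancels the
   [M phi_k] part of [L phi_(k+1)]. *)
rewrite -(hahn_coefS b N m k kN) hahnL_phi // -natr1.
by ring.
Qed.

End Phi.

Lemma hahnL_sum {R : realFieldType} (a b : R) (N n k : nat) (K : R)
    (c : nat -> R) (f : nat -> R -> R) :
  hahnL a b N n (fun x => K * \sum_(l < k) c l * f l x) =
  K * \sum_(l < k) c l * hahnL a b N n (f l).
Proof.
rewrite /hahnL; elim: k => [|k IH]; first by rewrite !big_ord0; ring.
by rewrite !big_ord_recr /= [RHS]mulrDr -IH; ring.
Qed.

Lemma hahnM_sum {R : realFieldType} (a : R) (n k : nat) (K : R)
    (c : nat -> R) (f : nat -> R -> R) :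
  hahnM a n (fun x => K * \sum_(l < k) c l * f l x) =
  K * \sum_(l < k) c l * hahnM a n (f l).
Proof.
rewrite /hahnM; elim: k => [|k IH]; first by rewrite !big_ord0; ring.
by rewrite !big_ord_recr /= [RHS]mulrDr -IH; ring.
Qed.

Theorem proposition8 (R : realFieldType) (N : nat) (a b : R)
    (hgen : hahn_generic a b N) (m n : nat) (hm : (m <= N)%N) (hn : (n <= N)%N) :
  hahnB a N n * hahnU m (n%:R + 1) a b N
  - (hahnB a N n + hahnD a b N n) * hahnU m n%:R a b N
  + hahnD a b N n * hahnU m (n%:R - 1) a b N
  = m%:R * (m%:R + b - N%:R) *
    ((a - n%:R) * hahnU m n%:R a b N + n%:R * hahnU m (n%:R - 1) a b N).
Proof.
have ha x l : (x <= N)%N -> (l <= N)%N -> poch (a - x%:R) l != 0.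
  (* Genericity is used at degree [N], which covers every [l <= N] at once. *)
  move=> xN lN; have [_ /(_ l lN)] := hgen N x (leqnn N) xN.
  by rewrite /hahn_den mulf_eq0 => /norP[].
rewrite !hahnU_phi; set K := (-1) ^+ m * _ / _.
have := hahnL_sum a b N n m.+1 K (hahn_coef b N m) (hahn_phi a).
rewrite {1}/hahnL => ->.
have := hahnM_sum a n m.+1 K (hahn_coef b N m) (hahn_phi a).
rewrite {1}/hahnM => ->.
have := hahn_sum_telescope a b N n hn ha m m hm (leqnn m).
rewrite subrr mul0r mulr0 mul0r => tel.
apply/eqP; rewrite mulrCA -subr_eq0 -mulrBr mulf_eq0; apply/orP; right.
rewrite mulr_sumr -sumrB; apply/eqP; rewrite -[RHS]tel.
by apply: eq_bigr => l _; ring.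
Qed.
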